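(* Let $V_0$ be an interior vertex of valence $n$ of a triangulated structure in the plane with nondegenerate triangles, and let $V_1,\dots,V_n$ be its adjacent vertices in cyclic order (indices taken modulo $n$). Then the compatibility condition at $V_0$ for the problem of prescribed elongations is the linear equation $$0=\sum_{i=1}^n\frac{L_{i,i+1}}{h_i}-\sum_{i=1}^n\left\{\frac{\cos\beta_i}{h_i}+\frac{\cos\gamma_i}{h_{i-1}}\right\}L_i ,$$ where $L_i$ is the elongation of the radial edge $V_0V_i$, $L_{i,i+1}$ is the elongation of the circumferential edge $V_iV_{i+1}$, $\beta_i=\angle V_0V_iV_{i+1}$, $\gamma_i=\angle V_0V_iV_{i-1}$, and $h_i$ is the distance from $V_0$ to the line through $V_i$ and $V_{i+1}$.
   Context: A triangulated structure consists of the vertices and (straight) edges of a piecewise linear triangulation of a planar domain: a tiling by finitely many non-overlapping closed triangles that meet only in a common vertex or along a whole common edge. Write $\ell_i=|V_iV_0|$, $\ell_{i,i+1}=|V_iV_{i+1}|$, $\alpha_i=\angle V_iV_0V_{i+1}$; the angles are determined by the lengths via the cosine law $\ell_{i,i+1}^2=\ell_i^2+\ell_{i+1}^2-2\ell_i\ell_{i+1}\cos\alpha_i$, and $h_i=\ell_i\sin\beta_i=\ell_{i+1}\sin\gamma_{i+1}$. The elongation of an edge is the derivative at $t=0$ of its length under a one-parameter variation $\ell(t)$ of the edge lengths. The compatibility condition at the interior vertex $V_0$ is the linear equation on elongations obtained by differentiating at $t=0$ the planarity requirement $\sum_{i=1}^n\alpha_i(t)=2\pi$, where the $\alpha_i(t)$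 are computed from the varying lengths by the cosine law. *)

(* Defs.v *)
From HB Require Import structures.
From mathcomp Require Import all_boot all_order all_algebra.
From mathcomp Require Import all_classical all_reals all_analysis.

Set Implicit Arguments.
Unset Strict Implicit.
Unset Printing Implicit Defensive.
Import Order.TTheory GRing.Theory Num.Theory numFieldNormedType.Exports.

Local Open Scope classical_set_scope.
Local Open Scope ring_scope.

Notation plane R := 'rV[R]_2.

Definition dot (R : realType) (u w : plane R) : R := \sum_j u 0 j * w 0 j.

(* The library norm on ['rV[R]_2] is the sup norm, hence the explicit
   Euclidean norm. *)
Definition enorm (R : realType) (u : plane R) : R := Num.sqrt (dot u u).

Definition dist (R : realType) (a b : plane R) : R := enorm (b - a).

Definition angle (R : realType) (a b c : plane R) : R :=
  acos (dot (a - b) (c - b) / (enorm (a - b) * enorm (c - b))).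

Definition line (R : realType) (b c : plane R) : set (plane R) :=
  [set b + s *: (c - b) | s in [set: R]].

Definition dist_to_line (R : realType) (a b c : plane R) : R :=
  inf [set dist a p | p in line b c].

Definition collinear (R : realType) (a b c : plane R) : Prop :=
  exists p u : plane R, [/\ exists s, a = p + s *: u,
    exists s, b = p + s *: u & exists s, c = p + s *: u].

Definition hull (R : realType) (V : finType) (pos : V -> plane R)
    (S : {set V}) : set (plane R) :=
  [set p | exists2 a : V -> R, forall v, 0 <= a v &
     \sum_(v in S) a v = 1 /\ p = \sum_(v in S) a v *: pos v].

(* Vertices are labelled by [V], a triangle is the set of its three vertices.
   For distinct triangles [T1], [T2] the set [T1 :&: T2] has at most two
   elements, so [triangles_meet] says that they are disjoint, or meet exactly in a
   common vertex, or meet exactly along a whole common edge. *)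
Record triangulated_structure (R : realType) (V : finType) :=
  TriangulatedStructure {
    pos :> V -> plane R;
    pos_inj : injective pos;
    triangles : {set {set V}};
    triangles_cover : finset.cover triangles = [set: V]%SET;
    triangles_card : forall T, T \in triangles -> #|T| = 3%N;
    triangles_nondegenerate : forall u v w, [set u; v; w]%SET \in triangles ->
      ~ collinear (pos u) (pos v) (pos w);
    triangles_meet : forall T1 T2, T1 \in triangles -> T2 \in triangles ->
      hull pos T1 `&` hull pos T2 = hull pos (T1 :&: T2) }.

Section TriangulatedStructure.
Context (R : realType) (V : finType) (S : triangulated_structure R V).

Definition domain : set (plane R) :=
  \bigcup_(T in [set` triangles S]) hull S T.

Definition edges : {set {set V}} :=
  [set e : {set V} | (#|e| == 2%N)
                     && [exists T in triangles S, e \subset T]]%SET.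

Definition interior_vertex (v0 : V) : Prop := domain° (S v0).

(* [v] lists without repetition the neighbours of [v0], so that [n] is the
   valence of [v0]; the triangles around [v0] are those spanned by [v0] and
   two successive neighbours. The successor [ordS i] is taken modulo [n]. *)
Definition cyclic_neighbours (v0 : V) (n : nat) (v : 'I_n -> V) : Prop :=
  [/\ injective v,
      forall u, [set v0; u]%SET \in edges <-> exists i, u = v i &
      forall T, (T \in triangles S /\ v0 \in T) <->
                exists i, T = [set v0; v i; v (ordS i)]%SET].

(* [l e t] is the length at time [t] of the edge [e]. *)
Definition length_variation (l : {set V} -> R -> R) : Prop :=
  forall u w, [set u; w]%SET \in edges ->
    l [set u; w]%SET 0 = dist (S u) (S w).

Definition has_elongations (l : {set V} -> R -> R) (L : {set V} -> R) : Prop :=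
  forall e, e \in edges -> is_derive (0 : R) (1 : R) (l e) (L e).

End TriangulatedStructure.

(* The angle between the sides of lengths [a] and [b] in a triangle whose third
   side has length [c]. *)
Definition cosine_law_angle (R : realType) (a b c : R) : R :=
  acos ((a ^+ 2 + b ^+ 2 - c ^+ 2) / (2 * a * b)).

Definition angle_sum (R : realType) (V : finType) (v0 : V) (n : nat)
    (v : 'I_n -> V) (l : {set V} -> R -> R) (t : R) : R :=
  \sum_(i < n) cosine_law_angle (l [set v0; v i]%SET t)
                                (l [set v0; v (ordS i)]%SET t)
                                (l [set v i; v (ordS i)]%SET t).

(* The planarity requirement [angle_sum v0 v l t = 2 * pi], differentiated at
   [t = 0], as a condition on the elongations [L]. *)
Definition compatibility_condition (R : realType) (V : finType)
    (S : triangulated_structure R V) (v0 : V) (n : nat) (v : 'I_n -> V)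
    (L : {set V} -> R) : Prop :=
  forall l, length_variation S l -> has_elongations S l L ->
    is_derive (0 : R) (1 : R) (fun t => angle_sum v0 v l t - 2 * pi) 0.

(* Main.v *)
Require Import Defs.
From HB Require Import structures.
From mathcomp Require Import all_boot all_order all_algebra.
From mathcomp Require Import all_classical all_reals all_analysis.
From mathcomp Require Import ring.
Import Order.TTheory GRing.Theory Num.Theory numFieldNormedType.Exports.
Local Open Scope classical_set_scope.
Local Open Scope ring_scope.

(** In a triangle with sides [a], [b], [c] and twice-area [D], the angle [alpha]
between [a] and [b] has [sin alpha = D / (a b)] (Heron), so differentiating the
cosine law gives
[alpha' = (c c' - (a^2+c^2-b^2)/(2a) a' - (b^2+c^2-a^2)/(2b) b') / D].
Since the height on [c] is [h = D / c] and, by the cosine law again, the two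
fractions are [c] times the cosines of the base angles, this is
[alpha' = c'/h - cos beta / h a' - cos gamma / h b']. Summing over the triangles
around the vertex and shifting the index in the [gamma] terms gives the
differential of the angle sum. *)

(** * Determinants, distances and angles in the plane *)

Section PlaneGeometry.
Context {R : realType}.
Implicit Types (a b c u w : plane R).

(** The determinant of two vectors: [cross (b - a) (c - a)] is twice the signed area of the triangle
    [a b c]. *)
Definition cross u w : R := u 0 0 * w 0 1 - u 0 1 * w 0 0.

Lemma dotE u w : dot u w = u 0 0 * w 0 0 + u 0 1 * w 0 1.
Proof.
rewrite /dot big_ord_recl big_ord1; congr (_ + u _ _ * w _ _); exact: val_inj.
Qed.

Lemma plane_eqP u w : u 0 0 = w 0 0 -> u 0 1 = w 0 1 -> u = w.
Proof.
move=> e0 e1; apply/rowP => i.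
case: i => [[|[|//]]] Hi; [have -> : Ordinal Hi = 0 by exact: val_inj|
  have -> : Ordinal Hi = 1 by exact: val_inj]; by [].
Qed.

Lemma dot_ge0 u : 0 <= dot u u.
Proof. by rewrite dotE -!expr2 addr_ge0 ?sqr_ge0. Qed.

Lemma sqr_enorm u : enorm u ^+ 2 = dot u u.
Proof. by rewrite sqr_sqrtr ?dot_ge0. Qed.

Lemma dist_ge0 a b : 0 <= dist a b.
Proof. exact: sqrtr_ge0. Qed.

Lemma dist_self a : dist a a = 0.
Proof. by rewrite /dist /enorm subrr dotE !mxE !mul0r addr0 sqrtr0. Qed.

Lemma dist_sym a b : dist a b = dist b a.
Proof. by rewrite /dist /enorm !dotE !mxE; congr Num.sqrt; ring. Qed.

Lemma lagrange_identity u w : dot u u * dot w w = dot u w ^+ 2 + cross u w ^+ 2.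
Proof. rewrite !dotE /cross; ring. Qed.

Lemma cross_subCr a b c : cross (b - a) (c - b) = cross (b - a) (c - a).
Proof. rewrite /cross !mxE; ring. Qed.

(** By Lagrange's identity a nonzero determinant makes the product of the squared norms positive. *)
Lemma cross_enorm_gt0 u w : cross u w != 0 -> 0 < enorm u /\ 0 < enorm w.
Proof.
move=> D0; have : 0 < dot u u * dot w w.
  by rewrite lagrange_identity ltr_wpDl ?sqr_ge0 // exprn_even_gt0.
rewrite -!sqr_enorm => P.
split; rewrite lt_neqAle sqrtr_ge0 andbT eq_sym; apply/eqP => e;
  by move: P; rewrite e expr0n /= ?mul0r ?mulr0 ltxx.
Qed.

Lemma cross_eq0_parallel u w : dot u u != 0 -> cross u w = 0 ->
  w = (dot u w / dot u u) *: u.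
Proof.
rewrite /cross !dotE => u0 D0; apply: plane_eqP; rewrite !mxE;
  apply: (mulIf u0); rewrite mulrAC divfK //; apply/eqP; rewrite -subr_eq0.
  rewrite (_ : _ - _ = - u 0 1 * (u 0 0 * w 0 1 - u 0 1 * w 0 0)); last by ring.
  by rewrite D0 mulr0.
rewrite (_ : _ - _ = u 0 0 * (u 0 0 * w 0 1 - u 0 1 * w 0 0)); last by ring.
by rewrite D0 mulr0.
Qed.

Lemma collinear_cross a b c : cross (b - a) (c - a) = 0 -> collinear a b c.
Proof.
(* If [b = a], then [b - a] spans no line and [c - a] serves as direction instead. *)
move=> D0; have [e|ne] := eqVneq (dot (b - a) (b - a)) 0.
  exists a, (c - a); have -> : b = a.
    move/eqP: e; rewrite dotE -!expr2 paddr_eq0 ?sqr_ge0 // !sqrf_eq0 !mxE.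
    by rewrite !subr_eq0 => /andP[/eqP e0 /eqP e1]; apply: plane_eqP.
  by split; [exists 0|exists 0|exists 1];
    rewrite ?scale0r ?scale1r ?addr0 // addrC subrK.
exists a, (b - a); split; [by exists 0; rewrite scale0r addr0| |].
  by exists 1; rewrite scale1r addrC subrK.
exists (dot (b - a) (c - a) / dot (b - a) (b - a)).
by rewrite -cross_eq0_parallel // addrC subrK.
Qed.

(** Lagrange's identity for [c - b] and the vector from [a] to the running point of the line. Their
    determinant does not depend on [s], so only the first square varies. *)
Lemma sqr_dist_line a b c s :
  dist a (b + s *: (c - b)) ^+ 2 * dist b c ^+ 2 =
  (s * dist b c ^+ 2 - dot (a - b) (c - b)) ^+ 2 + cross (b - a) (c - a) ^+ 2.
Proof. by rewrite /dist !sqr_enorm !dotE /cross !mxE; ring. Qed.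

Lemma dist_to_lineE a b c : 0 < dist b c ->
  dist_to_line a b c = `|cross (b - a) (c - a)| / dist b c.
Proof.
move=> bc0.
have lb : lbound [set dist a p | p in line b c]
              (`|cross (b - a) (c - a)| / dist b c).
  move=> _ [_ [s _ <-] <-]; rewrite ler_pdivrMr //.
  rewrite -(@ler_pXn2r _ 2) ?nnegrE ?mulr_ge0 ?dist_ge0 ?normr_ge0 //.
  by rewrite exprMn sqr_dist_line real_normK ?num_real // lerDr sqr_ge0.
have foot : [set dist a p | p in line b c]
              (`|cross (b - a) (c - a)| / dist b c).
  (* The parameter of the foot of the perpendicular from [a]; it makes the first square of
     [sqr_dist_line] vanish. *)
  pose s := dot (a - b) (c - b) / dist b c ^+ 2.
  exists (b + s *: (c - b)); first by exists s.
  apply: (mulIf (lt0r_neq0 bc0)); rewrite divfK ?gt_eqF //.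
  apply/eqP; rewrite -(@eqrXn2 _ 2) ?mulr_ge0 ?dist_ge0 ?normr_ge0 //.
  rewrite exprMn sqr_dist_line /s divfK ?expf_neq0 ?(lt0r_neq0 bc0) //.
  rewrite subrr expr0n add0r.
  by rewrite real_normK ?num_real.
apply/eqP; rewrite eq_le; apply/andP; split; last first.
  by apply: lb_le_inf => //; exists (`|cross (b - a) (c - a)| / dist b c).
by apply: ge_inf => //; exists (`|cross (b - a) (c - a)| / dist b c).
Qed.

Lemma angleE a b c :
  angle a b c = cosine_law_angle (dist b a) (dist b c) (dist a c).
Proof.
rewrite /angle /cosine_law_angle; congr acos.
have -> : dist b a ^+ 2 + dist b c ^+ 2 - dist a c ^+ 2 =
          2 * dot (a - b) (c - b).
  by rewrite /dist !sqr_enorm !dotE !mxE; ring.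
by rewrite -[2 * dist b a * _]mulrA -mulf_div divff ?mul1r ?pnatr_eq0.
Qed.

(** Heron's formula, both sides being 16 times the squared area: the subtracted square is that of
    [2 * dot (b - a) (c - a)], so Lagrange's identity applies. *)
Lemma heron_cross a b c :
  (2 * cross (b - a) (c - a)) ^+ 2 = (2 * dist a b * dist a c) ^+ 2
    - (dist a b ^+ 2 + dist a c ^+ 2 - dist b c ^+ 2) ^+ 2.
Proof.
rewrite !exprMn /dist !sqr_enorm -mulrA lagrange_identity /cross !dotE !mxE.
ring.
Qed.

(** * Differentiating the cosine law *)

(** The bounds are strict because [acos] is differentiated only in the open interval. *)
Lemma heron_cosine_bound (a b c D : R) : 0 < a -> 0 < b -> D != 0 ->
  (2 * D) ^+ 2 = (2 * a * b) ^+ 2 - (a ^+ 2 + b ^+ 2 - c ^+ 2) ^+ 2 ->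
  -1 < (a ^+ 2 + b ^+ 2 - c ^+ 2) / (2 * a * b) < 1.
Proof.
move=> a0 b0 D0 H; have ab0 : 0 < 2 * a * b by rewrite !mulr_gt0.
rewrite -ltr_norml normrM normfV (gtr0_norm ab0) ltr_pdivrMr // mul1r.
rewrite -(@ltr_pXn2r _ 2) ?nnegrE ?normr_ge0 ?ltW // real_normK ?num_real //.
by rewrite -subr_gt0 -H exprn_even_gt0 //= mulf_neq0 ?pnatr_eq0.
Qed.

Lemma is_derive_cosine_law_angle (a b c : R -> R) (x a' b' c' D : R) :
  0 < a x -> 0 < b x -> 0 < D ->
  (2 * D) ^+ 2
    = (2 * a x * b x) ^+ 2 - (a x ^+ 2 + b x ^+ 2 - c x ^+ 2) ^+ 2 ->
  is_derive x 1 a a' -> is_derive x 1 b b' -> is_derive x 1 c c' ->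
  is_derive x 1 (fun t => cosine_law_angle (a t) (b t) (c t))
    ((c x * c' - (a x ^+ 2 + c x ^+ 2 - b x ^+ 2) / (2 * a x) * a'
               - (b x ^+ 2 + c x ^+ 2 - a x ^+ 2) / (2 * b x) * b') / D).
Proof.
move=> a0 b0 D0 H Ha Hb Hc.
have q1 := heron_cosine_bound _ _ _ _ a0 b0 (lt0r_neq0 D0) H.
have ab0 : (cst 2 * a * b) x != 0.
  by rewrite /= !mulf_neq0 ?pnatr_eq0 ?gt_eqF.
have dnum := is_deriveB (is_deriveD (is_deriveX 2 Ha) (is_deriveX 2 Hb))
  (is_deriveX 2 Hc).
have dden := is_deriveM (is_deriveM (is_derive_cst (2 : R) x 1) Ha) Hb.
have dq := is_deriveM dnum (is_deriveV ab0 dden).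
rewrite /cosine_law_angle.
have ax0 := lt0r_neq0 a0; have bx0 := lt0r_neq0 b0; have Dn0 := lt0r_neq0 D0.
(* The square root is the sine of the angle, in the form in which it enters the derivative of
   [acos]; the sign of [D] selects the root. *)
have sinE :
    Num.sqrt (1 - ((a x ^+ 2 + b x ^+ 2 - c x ^+ 2) / (2 * a x * b x)) ^+ 2)
    = D / (a x * b x).
  rewrite -[RHS]ger0_norm ?divr_ge0 ?mulr_ge0 ?ltW // -sqrtr_sqr.
  congr Num.sqrt.
  have -> : (D / (a x * b x)) ^+ 2 = (2 * D) ^+ 2 / (2 * a x * b x) ^+ 2.
    by field; rewrite ?ax0 ?bx0.
  by rewrite H; field; rewrite ?ax0 ?bx0.
have dacos : is_derive
    (((a ^+ 2 + b ^+ 2 - c ^+ 2) * (fun t => ((cst 2 * a * b) t)^-1)) x) 1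
    acos (- (D / (a x * b x))^-1).
  by rewrite -sinE; exact: is_derive1_acos.
apply: (is_derive_eq (is_derive1_comp dacos dq)).
rewrite /GRing.scale /= !fctE /=.
by field; rewrite ?ax0 ?bx0 ?Dn0.
Qed.

Lemma is_derive_triangle_angle p q r (lq lr lqr : R -> R) (t q' r' qr' : R) :
  ~ collinear p q r ->
  lq t = dist p q -> lr t = dist p r -> lqr t = dist q r ->
  is_derive t 1 lq q' -> is_derive t 1 lr r' -> is_derive t 1 lqr qr' ->
  let h := dist_to_line p q r in
  is_derive t 1 (fun s => cosine_law_angle (lq s) (lr s) (lqr s))
    (qr' / h - cos (angle p q r) / h * q' - cos (angle p r q) / h * r').
Proof.
move=> ncol Eq Er Eqr dq dr dqr h.
have D0 : cross (q - p) (r - p) != 0.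
  by apply/eqP => /collinear_cross.
have [q0 r0] := cross_enorm_gt0 _ _ D0.
(* The third side is positive because the determinant is the same when [r - p] is replaced by
   [r - q]. *)
have [_ qr0] : 0 < enorm (q - p) /\ 0 < enorm (r - q).
  by apply: cross_enorm_gt0; rewrite cross_subCr.
rewrite -/(dist p q) -/(dist p r) -/(dist q r) in q0 r0 qr0.
have HD := heron_cross p q r.
have Dpos : 0 < `|cross (q - p) (r - p)| by rewrite normr_gt0.
have hE : h = `|cross (q - p) (r - p)| / dist q r by exact: dist_to_lineE.
(* The orientation of [p q r] is arbitrary, so the absolute value of the determinant plays the role
   of [D]. *)
have HD' : (2 * `|cross (q - p) (r - p)|) ^+ 2
           = (2 * cross (q - p) (r - p)) ^+ 2.
  by rewrite !exprMn real_normK ?num_real.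
have cosq : cos (angle p q r) =
    (dist p q ^+ 2 + dist q r ^+ 2 - dist p r ^+ 2) / (2 * dist p q * dist q r).
  rewrite angleE (dist_sym q p) acosK // in_itv /=.
  have /andP[] : -1 < (dist p q ^+ 2 + dist q r ^+ 2 - dist p r ^+ 2)
        / (2 * dist p q * dist q r) < 1; last by move=> *; rewrite !ltW.
  (* Heron's expression is symmetric in the three sides, so the bound found for the angle at [p]
     also holds at [q]. *)
  by apply: (heron_cosine_bound _ _ _ _ q0 qr0 D0); rewrite HD; ring.
have cosr : cos (angle p r q) =
    (dist p r ^+ 2 + dist q r ^+ 2 - dist p q ^+ 2) / (2 * dist p r * dist q r).
  rewrite angleE (dist_sym r p) (dist_sym r q) acosK // in_itv /=.
  have /andP[] : -1 < (dist p r ^+ 2 + dist q r ^+ 2 - dist p q ^+ 2)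
        / (2 * dist p r * dist q r) < 1; last by move=> *; rewrite !ltW.
  by apply: (heron_cosine_bound _ _ _ _ r0 qr0 D0); rewrite HD; ring.
rewrite hE cosq cosr; rewrite -Eq in q0 HD *; rewrite -Er in r0 HD *.
rewrite -Eqr in qr0 HD *; rewrite -HD' in HD.
apply: (is_derive_eq
  (is_derive_cosine_law_angle _ _ _ _ _ _ _ _ q0 r0 Dpos HD dq dr dqr)).
by field; rewrite !lt0r_neq0.
Qed.

End PlaneGeometry.

(** * A length variation realising given elongations *)

Section EdgeLengths.
Context {R : realType} {V : finType} (S : triangulated_structure R V).

(* The endpoints of an edge are not ordered: the sum counts every pair twice. *)
Definition edge_length (e : {set V}) : R :=
  (\sum_(x in e) \sum_(y in e) dist (S x) (S y)) / 2.

Lemma edge_lengthE u w : u != w ->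
  edge_length [set u; w]%SET = dist (S u) (S w).
Proof.
move=> uw; rewrite /edge_length !(big_setU1, big_set1) ?inE //=.
by rewrite !dist_self (dist_sym (S w)); field.
Qed.

Lemma edge_neq u w : [set u; w]%SET \in edges S -> u != w.
Proof. by rewrite inE cards2 => /andP[+ _]; case: (u != w). Qed.

(** Every [L] is realised by lengths affine in time, so a condition quantified over all variations
    can be tested on this one. *)
Lemma affine_length_variation (L : {set V} -> R) :
  length_variation S (fun e t => edge_length e + t * L e).
Proof. by move=> u w /edge_neq uw; rewrite mul0r addr0 edge_lengthE. Qed.

Lemma affine_has_elongations (L : {set V} -> R) :
  has_elongations S (fun e t => edge_length e + t * L e) L.
Proof.
move=> e _.
have d := is_deriveD (is_derive_cst (edge_length e) (0 : R) 1)
  (is_deriveM (is_derive_id (0 : R) 1) (is_derive_cst (L e) (0 : R) 1)).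
by apply: (is_derive_eq d); rewrite scale0r !add0r; exact: mulr1.
Qed.

End EdgeLengths.

Theorem theorem4 (R : realType) (V : finType)
    (S : triangulated_structure R V) (v0 : V) (n : nat) (v : 'I_n -> V)
    (v0_interior : interior_vertex S v0)
    (v_cyclic : cyclic_neighbours S v0 v) :
  let beta i := angle (S v0) (S (v i)) (S (v (ordS i))) in
  let gamma i := angle (S v0) (S (v i)) (S (v (ord_pred i))) in
  let h i := dist_to_line (S v0) (S (v i)) (S (v (ordS i))) in
  let form (L : {set V} -> R) :=
    \sum_(i < n) L [set v i; v (ordS i)]%SET / h i
    - \sum_(i < n) (cos (beta i) / h i + cos (gamma i) / h (ord_pred i))
                   * L [set v0; v i]%SET in
  (forall l L, length_variation S l -> has_elongations S l L ->
     is_derive (0 : R) (1 : R) (angle_sum v0 v l) (form L))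
  /\ (forall L, compatibility_condition S v0 v L <-> 0 = form L).

Proof.
move=> beta gamma h form; case: v_cyclic => _ neigh tri.
have tri_i i : [set v0; v i; v (ordS i)]%SET \in triangles S.
  by have [] := (tri [set v0; v i; v (ordS i)]%SET).2 (ex_intro _ i erefl).
have edge_r i : [set v0; v i]%SET \in edges S by apply/neigh; exists i.
have edge_c i : [set v i; v (ordS i)]%SET \in edges S.
  rewrite inE cards2; apply/andP; split; last first.
    apply/existsP; exists [set v0; v i; v (ordS i)]%SET; rewrite tri_i /=.
    by apply/fintype.subsetP => x; rewrite !inE => /orP[]->; rewrite ?orbT.
  (* If successive neighbours coincided, the triangle would have at most two vertices. *)
  have := triangles_card (tri_i i).
  have [->|//] := eqVneq (v i) (v (ordS i)).
  by rewrite -finset.setUA finset.setUid cards2; case: (_ != _).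
have deriv l L : length_variation S l -> has_elongations S l L ->
     is_derive (0 : R) (1 : R) (angle_sum v0 v l) (form L).
  move=> hl hL.
  (* The form is regrouped by triangles: the cyclic shift [ordS] is a bijection of the indices, and
     it moves each [gamma] term to the triangle containing that angle. *)
  have formE : form L = \sum_(i < n)
      (L [set v i; v (ordS i)]%SET / h i
       - cos (beta i) / h i * L [set v0; v i]%SET
       - cos (gamma (ordS i)) / h i * L [set v0; v (ordS i)]%SET).
    rewrite !sumrB /form -addrA; congr (_ + _).
    under [in LHS]eq_bigr do rewrite mulrDl.
    rewrite big_split opprD; congr (_ - _).
    rewrite (reindex_inj (@ordS_inj n)) /=.
    by under eq_bigr do rewrite ordSK.
  rewrite formE /angle_sum -fct_sumE; apply: is_derive_sum => i.
  rewrite /gamma ordSK.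
  apply: is_derive_triangle_angle; rewrite ?hl //; try exact: hL.
  exact: triangles_nondegenerate (tri_i i).
split=> // L; split=> [cc|form0 l hl hL].
  (* On the affine variation the derivative of the angle sum minus [2 * pi] is both [form L - 0] and
     [0]; uniqueness of the derivative gives the equation. *)
  have d1 := deriv _ _ (affine_length_variation S L) (affine_has_elongations S L).
  have d2 := cc _ (affine_length_variation S L) (affine_has_elongations S L).
  have d3 := is_deriveB d1 (is_derive_cst (2 * pi : R) (0 : R) 1).
  rewrite -[RHS]subr0.
  apply: etrans (@derive_val _ _ _ _ _ _ _ d3).
  by rewrite (@derive_val _ _ _ _ _ _ _ d2).
have d1 := deriv l L hl hL.
apply: (is_derive_eq (is_deriveB d1 (is_derive_cst (2 * pi : R) (0 : R) 1))).
by rewrite -form0 subr0.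
Qed.
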